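(* Let $n\ge1$ and let $X$ be an absolutely continuous random variable with finite support $[0,b]$, $b>0$, and cdf $F$. Then $X$ has a power distribution, i.e. $F(x)=(x/b)^c$ for $0<x<b$ for some $c>0$, if and only if there is a constant $k$ such that $$\overline\varepsilon J(X_{n:n};t)=k\,m_F(t)\qquad\text{for all } t\in(0,b).$$
   Context: Having support $[0,b]$ means that the smallest closed set carrying the distribution has left endpoint $0$ and right endpoint $b$; in particular $F(t)>0$ for $t>0$. $X_{n:n}$ is the maximum of $n$ i.i.d. copies of $X$ (with cdf $F^n$). The dynamic cumulative past extropy of $X_{n:n}$ is $$\overline\varepsilon J(X_{n:n};t)=-\frac12\int_0^t\left(\frac{F(x)}{F(t)}\right)^{2n}dx .$$ The expected inactivity time is $m_F(t)=E(t-X\mid X\le t)=\int_0^tF(x)\,dx/F(t)$. *)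

(* Defs.v *)
From mathcomp Require Import all_boot all_order all_algebra.
From mathcomp Require Import all_classical all_reals all_analysis.
Set Implicit Arguments.
Unset Strict Implicit.
Unset Printing Implicit Defensive.
Import Order.TTheory GRing.Theory Num.Theory.
Import numFieldNormedType.Exports.
Local Open Scope classical_set_scope.
Local Open Scope ring_scope.

(* The smallest closed set carrying the law of X; since R is second countable,
   the intersection below is itself of full measure. *)
Definition law_support d (T : measurableType d) (R : realType)
    (P : probability T R) (X : {RV P >-> R}) : set R :=
  \bigcap_(C in [set C : set R | closed C /\ distribution P X (~` C) = 0%E]) C.

(* "X has support [a, b]" only constrains the endpoints: the support may have
   gaps inside [a, b]. *)
Definition support_endpoints d (T : measurableType d) (R : realType)
    (P : probability T R) (X : {RV P >-> R}) (a b : R) : Prop :=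
  [/\ law_support X a, law_support X b & law_support X `<=` `[a, b]].

Definition absolutely_continuous_law d (T : measurableType d) (R : realType)
    (P : probability T R) (X : {RV P >-> R}) : Prop :=
  distribution P X `<< (@lebesgue_measure R).

(* The library's cdf takes values in \bar R. *)
Definition rcdf d (T : measurableType d) (R : realType)
    (P : probability T R) (X : {RV P >-> R}) (x : R) : R :=
  fine (cdf X x).

(* Dynamic cumulative past extropy of X_{n:n}, the maximum of n i.i.d. copies
   of X: the cdf of X_{n:n} is F ^+ n, which enters squared. *)
Definition dcp_extropy_max d (T : measurableType d) (R : realType)
    (P : probability T R) (X : {RV P >-> R}) (n : nat) (t : R) : R :=
  - (1 / 2) *
    \int[@lebesgue_measure R]_(x in `[0, t]) (rcdf X x / rcdf X t) ^+ (2 * n).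

(* Expected inactivity time E(t - X | X <= t), conditioning on an event
   (of positive probability in all uses). *)
Definition inactivity_time d (T : measurableType d) (R : realType)
    (P : probability T R) (X : {RV P >-> R}) (t : R) : R :=
  (\int[P]_(w in [set w | X w <= t]) (t - X w)) / fine (P [set w | X w <= t]).

Definition power_distribution d (T : measurableType d) (R : realType)
    (P : probability T R) (X : {RV P >-> R}) (b : R) : Prop :=
  exists2 c : R, 0 < c &
    forall x : R, 0 < x -> x < b -> rcdf X x = (x / b) `^ c.

(* Main.v *)
(* Write F for the cdf of X, G t and H t for the integrals over [0, t] of F and
   F ^ 2n.  By Fubini the inactivity time is G / F, so the extropy condition
   says H = K F ^ (2n - 1) G with K = -2 k.  Then (ln H)' = (ln G)' / K, hence
   ln F = s ln G + e for constants s and e; as G' = F, this gives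
   (G / F)' = 1 - s, so G t = (1 - s) t F t.  Substituting back, ln F is affine
   in ln t, and F b = 1 and F 0 = 0 pin down F t = (t / b) ^ c with c > 0. *)
Require Import Defs.
From mathcomp Require Import all_boot all_order all_algebra.
From mathcomp Require Import all_classical all_reals all_analysis.
From mathcomp Require Import measurable_realfun ring lra.
Import Order.TTheory GRing.Theory Num.Theory.
Import numFieldNormedType.Exports.
Local Open Scope classical_set_scope.
Local Open Scope ring_scope.

(** * Zero derivative on an open interval *)

Lemma is_derive0_itvoo_cst {R : realType} (f : R -> R) (a b : R) :
  (forall x, a < x < b -> is_derive x 1 f 0) ->
  forall x y, a < x < b -> a < y < b -> f x = f y.
Proof.
move=> df x y; wlog xy : x y / x <= y.
  by move=> W xab yab; case: (leP x y) => [|/ltW] h; [|symmetry]; exact: W.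
move=> /andP[ax xb] /andP[ay yb].
have [||c _] := @MVT_segment R f (cst 0) x y xy.
- by move=> z; rewrite in_itv/= => /andP[xz zy]; apply: df; lra.
- apply: derivable_within_continuous => z; rewrite in_itv/= => /andP[xz zy].
  by apply: ex_derive; apply: df; lra.
- by move/eqP; rewrite mul0r subr_eq0 => /eqP.
Qed.

(** * Integrals of continuous functions: derivative and mean value *)

Section integral_of_continuous.
Context {R : realType}.
Local Notation mu := (@lebesgue_measure R).
Variable f : R -> R.
Hypothesis cf : continuous f.

Lemma continuous_itvcc_integrable (a b : R) : mu.-integrable `[a, b] (EFin \o f).
Proof.
apply: continuous_compact_integrable; first exact: segment_compact.
exact: continuous_subspaceT.
Qed.

Lemma is_derive_Rintegral (a x : R) : a < x ->
  is_derive x 1 (fun y => \int[mu]_(t in `[a, y]) f t) (f x).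
Proof.
move=> ax.
(* Any point beyond [x] would do: it only makes [x] interior to the interval of integrability. *)
have x1 : x < x + 1 by rewrite ltrDl.
have [D E] := @continuous_FTC1_closed R f a x (x + 1) x1
  (continuous_itvcc_integrable _ _) ax (cf x).
apply: DeriveDef; first exact: D.
by rewrite -derive1E.
Qed.

(** The point [c] being strictly interior matters: it gives positivity of integrals of [F] although
    [F 0 = 0], and, by monotonicity, the bound [G t <= t * F t]. *)
Lemma Rintegral_mean_value (a b : R) : a < b ->
  exists2 c, a < c < b & \int[mu]_(t in `[a, b]) f t = f c * (b - a).
Proof.
move=> ab.
have [||c] := @MVT R (fun y => \int[mu]_(t in `[a, y]) f t) f a b ab.
- move=> x; rewrite in_itv/= => /andP[ax _]; exact: is_derive_Rintegral.
- apply: parameterized_integral_continuous; first exact: ltW.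
  exact: continuous_itvcc_integrable.
rewrite in_itv/= => cab; rewrite set_itv1 Rintegral_set1 subr0 => E.
by exists c.
Qed.

End integral_of_continuous.

(** * Integrals of real powers from 0 *)

Section powR_integral.
Context {R : realType}.
Implicit Types c t x : R.

Lemma continuous_powR c x : 0 < x -> {for x, continuous (@powR R ^~ c)}.
Proof.
move=> x0; apply/differentiable_continuous/derivable1_diffP.
by apply: derivable_powR; rewrite in_itv/= x0.
Qed.

(** At 0 only the limit from the right counts; [0 < c] makes it agree with the value 0 there. *)
Lemma within_continuous_powR c t : 0 < c -> 0 < t ->
  {within `[0, t], continuous (@powR R ^~ c)}.
Proof.
move=> c0 t0; apply/(continuous_within_itvP _ t0); split.
- by move=> x; rewrite in_itv/= => /andP[x0 _]; exact: continuous_powR.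
- by rewrite powR0 ?gt_eqF//; exact: powR_cvg0.
- by apply: cvg_at_left_filter; exact: continuous_powR.
Qed.

Lemma integrable_powR c t : 0 < c -> 0 < t ->
  (@lebesgue_measure R).-integrable `[0, t] (EFin \o (@powR R ^~ c)).
Proof.
move=> c0 t0; apply: continuous_compact_integrable; first exact: segment_compact.
exact: within_continuous_powR.
Qed.

Lemma Rintegral_powR c t : 0 < c -> 0 < t ->
  \int[@lebesgue_measure R]_(x in `[0, t]) (x `^ c) = t `^ (c + 1) / (c + 1).
Proof.
move=> c0 t0; have c1 : 0 < c + 1 by rewrite addr_gt0.
have dG x : 0 < x -> is_derive x 1 (fun y => y `^ (c + 1) / (c + 1)) (x `^ c).
  move=> x0.
  have -> : (fun y => y `^ (c + 1) / (c + 1)) = (c + 1)^-1 \*: (fun y => y `^ (c + 1)).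
    by apply/funext => y /=; rewrite mulrC.
  have D := is_derive1_powR (c + 1) x0.
  apply: (is_derive_eq (is_deriveZ _ D)).
  by rewrite addrK scalerA mulVf ?scale1r// gt_eqF.
rewrite /Rintegral (@continuous_FTC2 _ _ (fun x => x `^ (c + 1) / (c + 1)) 0 t t0).
- by rewrite [0 `^ _]powR0 ?gt_eqF// mul0r sube0.
- exact: within_continuous_powR.
- split.
  + by move=> x; rewrite in_itv/= => /andP[x0 _]; apply: ex_derive; exact: dG.
  + rewrite powR0 ?gt_eqF// mul0r -[X in _ --> X](mul0r (c + 1)^-1).
    exact: cvgMr_tmp (powR_cvg0 c1).
  + have h : {for t, continuous (fun y => y `^ (c + 1) / (c + 1))}.
      apply/differentiable_continuous/derivable1_diffP.
      by apply: ex_derive; exact: dG.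
    exact: cvg_at_left_filter h.
- move=> x; rewrite in_itv/= => /andP[x0 _].
  by rewrite derive1E; apply: derive_val; exact: dG.
Qed.

End powR_integral.

(** * The integral equation and its power solutions *)

Section proportional_primitives.
Context {R : realType}.
Local Notation mu := (@lebesgue_measure R).
Variables (F : R -> R) (b : R) (m : nat) (K : R).
Hypotheses (b0 : 0 < b) (cF : continuous F) (ndF : {homo F : x y / x <= y}).
Hypotheses (F0 : F 0 = 0) (Fgt0 : forall t : R, 0 < t -> 0 < F t) (Fb : F b = 1).
Local Notation G t := (\int[mu]_(x in `[0, t]) F x).
Local Notation H t := (\int[mu]_(x in `[0, t]) (F x ^+ m.+2)).
(** The extropy condition multiplied by [-2 * F t ^+ m.+2], where [m.+2] stands for [2 * n] and [K]
    for [-2 * k]. *)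
Hypothesis HG : forall t : R, 0 < t -> t < b -> H t = K * (F t ^+ m.+1 * G t).

Let cFX : continuous (fun x => F x ^+ m.+2).
Proof. by move=> x; exact: (continuous_comp (cF x) (@exprn_continuous R m.+2 (F x))). Qed.

Let b2 : 0 < b / 2 < b.
Proof. by rewrite divr_gt0//= ltr_pdivrMr// ltr_pMr// ltr1n. Qed.

Let G_gt0 (t : R) : 0 < t -> 0 < G t.
Proof.
move=> t0; have [c /andP[c0 _] ->] := @Rintegral_mean_value _ F cF 0 t t0.
by rewrite subr0 mulr_gt0// Fgt0.
Qed.

Let G_le (t : R) : 0 < t -> G t <= t * F t.
Proof.
move=> t0; have [c /andP[_ ct] ->] := @Rintegral_mean_value _ F cF 0 t t0.
by rewrite subr0 mulrC ler_pM2l// ndF// ltW.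
Qed.

Let H_gt0 (t : R) : 0 < t -> 0 < H t.
Proof.
move=> t0; have [c /andP[c0 _] ->] := @Rintegral_mean_value _ _ cFX 0 t t0.
by rewrite subr0 mulr_gt0// exprn_gt0// Fgt0.
Qed.

(** A single point of the interval suffices, as [H], [F] and [G] are all positive there. Positivity
    allows dividing by [K] and taking [ln K]. *)
Let K_gt0 : 0 < K.
Proof.
case/andP: b2 => b20 b2b; have := H_gt0 _ b20; rewrite HG// pmulr_lgt0//.
by rewrite mulr_gt0 ?G_gt0// exprn_gt0// Fgt0.
Qed.

Let is_derive_lnG (t : R) : 0 < t -> is_derive t 1 (fun x : R => ln (G x)) (F t / G t).
Proof.
move=> t0; rewrite mulrC.
apply: (is_derive1_comp (is_derive1_ln (G_gt0 _ t0))).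
exact: is_derive_Rintegral.
Qed.

Let is_derive_lnH (t : R) : 0 < t ->
  is_derive t 1 (fun x => ln (H x)) (F t ^+ m.+2 / H t).
Proof.
move=> t0; rewrite mulrC.
apply: (is_derive1_comp (is_derive1_ln (H_gt0 _ t0))).
exact: (is_derive_Rintegral _ cFX).
Qed.

(* [(ln H)' = F ^+ m.+2 / H = K^-1 * (F / G) = K^-1 * (ln G)'], so no
   differentiability of [F] is needed. *)
Let ln_F_affine : exists s e, forall t : R, 0 < t < b -> ln (F t) = s * ln (G t) + e.
Proof.
have lnHG : forall x y : R, 0 < x < b -> 0 < y < b ->
    ln (H x) - K^-1 * ln (G x) = ln (H y) - K^-1 * ln (G y).
  apply: is_derive0_itvoo_cst => x /andP[x0 xb].
  have dG := @is_deriveZ _ _ _ (fun x : R => ln (G x)) K^-1 x 1 _ (is_derive_lnG _ x0).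
  have := is_deriveB (is_derive_lnH _ x0) dG; move/is_derive_eq; apply.
  rewrite HG// exprS /GRing.scale/=; field.
  by rewrite !gt_eqF ?exprn_gt0 ?Fgt0 ?G_gt0 ?K_gt0.
(* The logarithm of [HG] is [ln H = ln K + m.+1 * ln F + ln G]. Equating this with [K^-1 * ln G]
   plus the constant found at [b / 2] and solving for [ln F] gives both witnesses. *)
exists ((K^-1 - 1) / m.+1%:R).
exists ((ln (H (b / 2)) - K^-1 * ln (G (b / 2)) - ln K) / m.+1%:R) => t tb.
rewrite -(lnHG t)//; case/andP: tb => t0 tb.
rewrite HG// !lnM ?posrE ?mulr_gt0 ?exprn_gt0 ?G_gt0 ?Fgt0//.
rewrite lnXn ?Fgt0// -mulr_natr; field.
by rewrite gt_eqF//= gt_eqF ?K_gt0.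
Qed.

(* [F = expR e * G `^ s] and [G' = F] make the derivative of [G / F] constant;
   the affine function [G / F] vanishes at 0 because [0 < G t / F t <= t]. *)
Let GF_linear : exists s e, [/\ 0 < 1 - s,
  forall t : R, 0 < t < b -> ln (F t) = s * ln (G t) + e &
  forall t : R, 0 < t < b -> G t = (1 - s) * t * F t].
Proof.
have [s [e lnF]] := ln_F_affine.
have FE (t : R) : 0 < t < b -> F t = expR (s * ln (G t) + e).
  by move=> tb; rewrite -lnF// lnK// posrE Fgt0//; case/andP: tb.
(* [M] equals [G / F] on the interval but is written through [G] alone, whose derivative is
   known. *)
pose M t := G t * expR (- (s * ln (G t) + e)).
have ME (t : R) : 0 < t < b -> M t = G t / F t.
  by move=> tb; rewrite /M expRN -FE.
have dM (t : R) : 0 < t < b -> is_derive t 1 (fun t : R => M t - (1 - s) * t) 0.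
  move=> tb; have /andP[t0 _] := tb.
  have d1 : is_derive t 1 (fun t : R => - (s * ln (G t) + e)) (- (s * (F t / G t) + 0)).
    apply: is_deriveN; apply: is_deriveD.
    exact: (@is_deriveZ _ _ _ (fun x : R => ln (G x)) s t 1 _ (is_derive_lnG _ t0)).
  have d2 := is_derive1_comp (is_derive_expR _) d1.
  have d3 := is_deriveM (is_derive_Rintegral _ cF 0 t t0) d2.
  have d4 := @is_deriveZ _ _ _ id (1 - s) t 1 _ (is_derive_id _ _).
  have := is_deriveB d3 d4; move/is_derive_eq; apply.
  rewrite /= expRN -FE// /GRing.scale/=; field.
  by rewrite !gt_eqF ?Fgt0 ?G_gt0.
have Mcst := is_derive0_itvoo_cst _ _ _ dM.
pose D := M (b / 2) - (1 - s) * (b / 2).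
have MD (t : R) : 0 < t < b -> M t = (1 - s) * t + D.
  by move=> tb; rewrite /D -(Mcst t)//; ring.
have Mt (t : R) : 0 < t < b -> 0 < M t <= t.
  move=> tb; have /andP[t0 _] := tb; rewrite ME//.
  by rewrite divr_gt0 ?G_gt0 ?Fgt0//= ler_pdivrMr ?Fgt0// G_le.
(* Both [M t] and [(1 - s) * t] are at most a constant times [t], so their difference [D] is smaller
   than any positive number. *)
have D0 : D = 0.
  have D_le (t : R) : 0 < t < b -> `|D| <= (1 + `|1 - s|) * t.
    move=> tb; have /andP[t0 _] := tb.
    have := Mt _ tb; rewrite MD// => /andP[Dl Du].
    rewrite mulrDl mul1r -{2}(gtr0_norm t0) -normrM ler_norml.
    have := ler_norm ((1 - s) * t); have := ler_norm (- ((1 - s) * t)).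
    rewrite normrN; lra.
  apply/eqP; rewrite -normr_le0 leNgt; apply/negP => D0.
  have c0 : 0 < 1 + `|1 - s| by rewrite ltr_pwDl.
  (* The second entry is half the value at which the bound on [D] becomes an equality; the first
     keeps [t] below [b]. *)
  pose t := Num.min (b / 2) (`|D| / (1 + `|1 - s|) / 2).
  have t0 : 0 < t by rewrite lt_min !divr_gt0.
  have tb : t < b by rewrite gt_min; case/andP: b2 => _ ->.
  have := D_le t; rewrite t0 tb => /(_ isT); rewrite mulrC -ler_pdivrMr//.
  apply/negP; rewrite -ltNge gt_min; apply/orP; right.
  have : 0 < `|D| / (1 + `|1 - s|) by rewrite divr_gt0.
  lra.
have s1 : 0 < 1 - s.
  have := Mt _ b2; rewrite MD// D0 addr0 => /andP[+ _].
  by rewrite pmulr_lgt0//; case/andP: b2.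
exists s; exists e; split=> // t tb; have := MD _ tb; rewrite D0 addr0 ME// => <-.
by rewrite mulfVK// gt_eqF// Fgt0//; case/andP: tb.
Qed.

Lemma power_of_proportional_primitives :
  exists2 c, 0 < c & forall x : R, 0 < x -> x < b -> F x = (x / b) `^ c.
Proof.
have [s [e [s1 lnF GE]]] := GF_linear.
(* Inserting [G t = (1 - s) * t * F t] gives [ln F = s * (ln (1 - s) + ln t + ln F) + e]; [c] and
   [e'] come from solving it for [ln F]. *)
pose c := s / (1 - s).
pose e' := (s * ln (1 - s) + e) / (1 - s).
have lnFE (t : R) : 0 < t < b -> ln (F t) = c * ln t + e'.
  move=> tb; have /andP[t0 _] := tb; have := lnF _ tb; rewrite GE//.
  rewrite !lnM ?posrE ?mulr_gt0 ?Fgt0// => E.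
  rewrite /c /e'; apply: (@mulfI _ (1 - s)); first by rewrite gt_eqF.
  rewrite [LHS]mulrBl mul1r {1}E; field; by rewrite gt_eqF.
(* The affine formula holds only left of [b], so [F b = 1] is brought in through the left limit. *)
have e'E : c * ln b + e' = 0.
  have c1 : c * ln t + e' @[t --> b^'-] --> c * ln b + e'.
    apply: cvgD; last exact: cvg_cst.
    apply: cvgMl_tmp; apply: cvg_at_left_filter; exact: continuous_ln.
  have c2 : ln (F t) @[t --> b^'-] --> ln (F b).
    have lnb : {for F b, continuous (@ln R)} by apply: continuous_ln; rewrite Fb.
    have := continuous_comp (cF b) lnb; exact: cvg_at_left_filter.
  have c3 : ln (F t) @[t --> b^'-] --> c * ln b + e'.
    apply: cvg_trans c1; apply: near_eq_cvg; near=> t; rewrite lnFE//.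
    apply/andP; split; first by near: t; exact: nbhs_left_gt.
    by near: t; exact: nbhs_left_lt.
  by have <- := cvg_unique (@Rhausdorff R) c2 c3; rewrite Fb ln1.
have FE (t : R) : 0 < t -> t < b -> F t = (t / b) `^ c.
  move=> t0 tb; apply: ln_inj; rewrite ?posrE ?powR_gt0 ?divr_gt0 ?Fgt0//.
  rewrite ln_powR ln_div ?posrE// lnFE ?t0//.
  have -> : e' = - (c * ln b) by apply/eqP; rewrite -addr_eq0 addrC e'E.
  by rewrite mulrBr.
exists c => //.
(* An exponent [c <= 0] would give [F t >= 1] on the whole interval, whereas [F] is below 1 near 0
   by continuity. *)
have [t /and3P[t0 tb Ft]] : exists t, [&& 0 < t, t < b & F t < 1].
  near (0 : R)^'+ => t; exists t; apply/and3P; split.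
  - by near: t; exact: nbhs_right_gt.
  - by near: t; exact: nbhs_right_lt.
  - near: t; have : F t @[t --> 0^'+] --> F 0 by apply: cvg_at_right_filter; exact: cF.
    by rewrite F0 => /cvgr_lt; apply.
have tb1 : t / b < 1 by rewrite ltr_pdivrMr// mul1r.
rewrite ltNge; apply/negP => c0; move: Ft; rewrite FE//; apply/negP; rewrite -leNgt.
rewrite -[X in X <= _](powRr0 (t / b)); apply: ger_powR => //.
by rewrite divr_gt0//= ltW.
Unshelve. all: by end_near. Qed.

End proportional_primitives.

(** * The cdf, its continuity, its values at the ends of the support, and its integral *)

Section random_variable_cdf.
Context {d : measure_display} {T : measurableType d} {R : realType}.
Context (P : probability T R) (X : {RV P >-> R}).
Local Notation mu := (@lebesgue_measure R).

Lemma rcdfE x : cdf X x = (rcdf X x)%:E.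
Proof. by rewrite /rcdf fineK// fin_num_measure. Qed.

Lemma rcdf_le x y : x <= y -> rcdf X x <= rcdf X y.
Proof. by move=> xy; rewrite -lee_fin -!rcdfE; exact: cdf_nondecreasing. Qed.

Lemma rcdf_ge0 x : 0 <= rcdf X x.
Proof. by rewrite -lee_fin -rcdfE; exact: cdf_ge0. Qed.

Lemma rcdfB x y : x <= y -> (rcdf X y - rcdf X x)%:E = distribution P X `]x, y].
Proof.
move=> xy; rewrite EFinB -!rcdfE /cdf.
have -> : `]-oo, y]%classic = `]-oo, x]%classic `|` `]x, y]%classic :> set R.
  by rewrite -itv_bndbnd_setU// bnd_simp.
rewrite measureU//; last first.
  apply/seteqP; split => // z; rewrite /= !in_itv/= => -[z1 /andP[z2 _]].
  by move: (le_lt_trans z1 z2); rewrite ltxx.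
by rewrite (addeC (distribution P X _)) addeK// fin_num_measure.
Qed.

Lemma cvg_rcdfNy0 : rcdf X x @[x --> -oo] --> (0 : R).
Proof.
have := @cvg_cdfNy0 _ _ _ _ X.
have -> : cdf X = EFin \o rcdf X by apply/funext => x; exact: rcdfE.
by move/fine_cvg.
Qed.

Lemma cvg_rcdfy1 : rcdf X x @[x --> +oo] --> (1 : R).
Proof.
have := @cvg_cdfy1 _ _ _ _ X.
have -> : cdf X = EFin \o rcdf X by apply/funext => x; exact: rcdfE.
by move/fine_cvg.
Qed.

(** Right continuity holds for every cdf. On the left, the rays ending at [a - n.+1%:R^-1] increase
    to the open ray below [a], which misses only the null set [[set a]]. *)
Lemma rcdf_continuous : absolutely_continuous_law X -> continuous (rcdf X).
Proof.
move=> ac a; apply/left_right_continuousP; split; last first.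
  have := @cdf_right_continuous _ _ _ _ X a.
  have -> : cdf X = EFin \o rcdf X by apply/funext => x; exact: rcdfE.
  by move/fine_cvg.
pose E n := `]-oo, a - n.+1%:R^-1]%classic : set R.
have mE n : measurable (E n) by exact: measurable_itv.
have EF : rcdf X (a - n.+1%:R^-1) @[n --> \oo] --> rcdf X a.
  have -> : rcdf X a = fine (distribution P X (\bigcup_n E n)).
    rewrite /rcdf /cdf; congr fine.
    have -> : `]-oo, a]%classic = `]-oo, a[%classic `|` [set a] :> set R.
      by rewrite setUitv1.
    rewrite measureU//; last first.
      by apply/seteqP; split => // z; rewrite /= in_itv/= => -[+ za]; rewrite za ltxx.
    have Xa : distribution P X [set a] = 0%E.
      apply: (ac [set a]) => //.
      by apply/measure0_null_setP => //; exact: lebesgue_measure_set1.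
    rewrite [X in (_ + X)%E](_ : _ = 0%E) ?adde0; last exact: Xa.
    congr (distribution P X _); apply/seteqP; split => z /=; rewrite in_itv/=.
    - rewrite -subr_gt0 => za.
      exists (Num.truncn (a - z)^-1) => //; rewrite /E/= in_itv/= lerBrDr addrC -lerBrDr.
      by rewrite invf_ple ?posrE// ltW// truncnS_gt.
    - move=> [n _]; rewrite /E/= in_itv/= => /le_lt_trans; apply.
      by rewrite ltrBlDr ltrDl.
  have : distribution P X (E n) @[n --> \oo] --> distribution P X (\bigcup_n E n).
    apply: nondecreasing_cvg_mu => //; first exact: bigcup_measurable.
    move=> m n mn; apply/subsetPset => z; rewrite /E/= !in_itv/= => /le_trans; apply.
    by rewrite lerB// lef_pV2 ?posrE// ler_nat.
  rewrite -[distribution P X (\bigcup_n E n)]fineK ?fin_num_measure//; last first.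
    exact: bigcup_measurable.
  by move/fine_cvg.
apply/cvgrPdist_lt => e e0.
have /cvgrPdist_lt /(_ e e0) [N _ /(_ N (leqnn N))/= FN] := EF.
(* Monotonicity squeezes [rcdf X y] between one term of the sequence and the value at [a]. *)
near=> y.
have ya : y <= a by apply/ltW; near: y; exact: nbhs_left_lt.
have yN : a - N.+1%:R^-1 <= y.
  by apply/ltW; near: y; apply: nbhs_left_gt; rewrite ltrBlDr ltrDl.
have := rcdf_le _ _ ya; have := rcdf_le _ _ yN.
move: FN; rewrite !ltr_norml; lra.
Unshelve. all: by end_near. Qed.

(* Local constancy off the support avoids proving that the support has full
   measure. *)
Lemma is_derive_rcdf_notin_support x : ~ law_support X x -> is_derive x 1 (rcdf X) 0.
Proof.
rewrite /law_support => /existsNP [C /not_implyP[[Ccl PC] Cx]].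
suff Fx : \forall y \near x, cst (rcdf X x) y = rcdf X y.
  exact: near_eq_is_derive Fx _.
have : nbhs x (~` C) by apply: open_nbhs_nbhs; split => //; exact: closed_openC.
move=> /nbhs_ballP [e /= e0 eC].
apply/nbhs_ballP; exists e => //= y xy.
have null u v : u <= v -> ball x e u -> ball x e v -> rcdf X u = rcdf X v.
  move=> uv xu xv; have := rcdfB _ _ uv.
  have mC : measurable (~` C) by apply: open_measurable; exact: closed_openC.
  have uvC : `]u, v]%classic `<=` ~` C.
    move=> z; rewrite /= in_itv/= => /andP[uz zv]; apply: eC.
    by move: xu xv; rewrite /ball/= !ltr_norml; lra.
  rewrite (subset_measure0 (measurable_itv _) mC uvC PC).
  by move=> [] /eqP; rewrite subr_eq0 => /eqP.
by case: (leP y x) => [/null|/ltW/null] ->//; exact: ballxx.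
Qed.

(** Left of [a] the cdf has zero derivative, hence is constant and equal to its limit 0 at minus
    infinity; continuity carries the value to [a]. *)
Lemma rcdf_support_left (a b : R) : absolutely_continuous_law X ->
  law_support X `<=` `[a, b] -> rcdf X a = 0.
Proof.
move=> ac Xab.
have cst0 x : x < a -> rcdf X x = 0.
  move=> xa.
  have : rcdf X y @[y --> -oo] --> rcdf X x.
    apply: cvg_near_cst; near=> y.
    have yx : y < x by near: y; apply: nbhs_ninfty_lt; exact: num_real.
    (* The shift to [y - 1] puts [y] strictly inside the interval. *)
    apply: (@is_derive0_itvoo_cst _ _ (y - 1) a); [|lra|lra].
    move=> z /andP[_ za]; apply: is_derive_rcdf_notin_support => /Xab.
    by rewrite /= in_itv/=; lra.
  by move=> h; exact: (cvg_unique (@Rhausdorff R) h cvg_rcdfNy0).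
have h : rcdf X y @[y --> a^'-] --> rcdf X a.
  by apply: cvg_at_left_filter; exact: rcdf_continuous.
have : rcdf X y @[y --> a^'-] --> (0 : R).
  by apply: cvg_near_cst; near=> y; apply: cst0.
by move=> h0; exact: (cvg_unique (@Rhausdorff R) h h0).
Unshelve. all: by end_near. Qed.

Lemma rcdf_support_right (a b : R) : absolutely_continuous_law X ->
  law_support X `<=` `[a, b] -> rcdf X b = 1.
Proof.
move=> ac Xab.
have cst1 x : b < x -> rcdf X x = 1.
  move=> xa.
  have : rcdf X y @[y --> +oo] --> rcdf X x.
    apply: cvg_near_cst; near=> y.
    have yx : x < y by near: y; apply: nbhs_pinfty_gt; exact: num_real.
    apply: (@is_derive0_itvoo_cst _ _ b (y + 1)); [|lra|lra].
    move=> z /andP[za _]; apply: is_derive_rcdf_notin_support => /Xab.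
    by rewrite /= in_itv/=; lra.
  by move=> h; exact: (cvg_unique (@Rhausdorff R) h cvg_rcdfy1).
have h : rcdf X y @[y --> b^'+] --> rcdf X b.
  by apply: cvg_at_right_filter; exact: rcdf_continuous.
have : rcdf X y @[y --> b^'+] --> (1 : R).
  by apply: cvg_near_cst; near=> y; apply: cst1.
by move=> h0; exact: (cvg_unique (@Rhausdorff R) h h0).
Unshelve. all: by end_near. Qed.

(** If the cdf vanished at [t], the closed ray from [t] on would carry the law, hence contain the
    support point [a < t]. *)
Lemma rcdf_gt0 (a t : R) : law_support X a -> a < t -> 0 < rcdf X t.
Proof.
move=> Xa at_; rewrite lt_neqAle rcdf_ge0 andbT; apply/negP => /eqP Ft.
have : `[t, +oo[%classic a.
  apply: Xa; split; first exact: rray_closed.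
  apply: (@subset_measure0 _ _ _ _ _ `]-oo, t]%classic) => //.
  - exact: measurableC.
  - by move=> z; rewrite /= !in_itv/= andbT => /negP; rewrite -ltNge => /ltW.
  - by rewrite -[LHS]/(cdf X t) rcdfE -Ft.
by rewrite /= in_itv/= andbT leNgt at_.
Qed.

(** For [X w <= t], [t - X w] is the length of the interval from [X w] to [t], which is empty when
    [X w > t]. Tonelli then swaps the integrals, and for fixed [x <= t] the inner one is the
    probability that [X <= x]. *)
Lemma Rintegral_inactivity (a t : R) : rcdf X a = 0 ->
  \int[P]_(w in [set w | X w <= t]) (t - X w) = \int[mu]_(x in `[a, t]) rcdf X x.
Proof.
move=> Fa; rewrite /Rintegral; congr fine.
pose f (p : T * measurableTypeR R) : \bar R := (\1_(`[X p.1, t]%classic) p.2)%:E.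
transitivity (\int[P]_w \int[mu]_x f (w, x))%E.
  rewrite integral_mkcond; apply: eq_integral => w _.
  rewrite /f/= integral_indic//= setIT lebesgue_measure_itv/= lte_fin patchE.
  case: ltgtP => Xt.
  - by rewrite mem_set//= ltW.
  - by rewrite memNset//=; apply/negP; rewrite -ltNge.
  - by rewrite mem_set//= ?Xt ?subrr.
transitivity (\int[mu]_x \int[P]_w f (w, x))%E.
  rewrite (fubini_tonelli f)//; last by move=> p; rewrite /f lee_fin.
  apply/measurable_EFinP.
  have -> : (fun p : T * measurableTypeR R => \1_(`[X p.1, t]%classic) p.2 : R) =
      \1_[set p | X p.1 <= p.2 /\ p.2 <= t].
    apply/funext => p; rewrite !indicE; congr (_ %:R); congr nat_of_bool.
    apply/idP/idP; rewrite !inE/= in_itv/=; first by move/andP.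
    by move=> [-> ->].
  apply: measurable_indic; apply: measurableI.
  - rewrite -[X in measurable X]setTI.
    apply: measurable_fun_le => //=.
    exact: (measurableT_comp (measurable_funPT X) measurable_fst).
  - rewrite -[X in measurable X]setTI.
    apply: measurable_fun_le => //=.
rewrite [RHS]integral_mkcond; apply: eq_integral => x _.
rewrite patchE; have [xt|tx] := leP x t; last first.
  have Nx y : ~ `[y, t]%classic x by rewrite /= in_itv/= => /andP[_]; rewrite leNgt tx.
  rewrite memNset/=; last exact: Nx.
  by apply: integral0_eq => w _; rewrite /f/= indicE memNset//; exact: Nx.
transitivity (\int[P]_w (\1_(X @^-1` `]-oo, x]) w)%:E)%E.
  apply: eq_integral => w _; rewrite /f/= !indicE; congr ((_ %:R)%:E); congr nat_of_bool.
  by apply/idP/idP; rewrite !inE/= !in_itv/= ?xt ?andbT.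
rewrite integral_indic//; last exact: measurable_funPTI.
rewrite setIT.
transitivity (cdf X x) => //; rewrite rcdfE.
(* Below [a] the cdf vanishes by monotonicity, so the integral may start at [a]. *)
case: ifPn => //; rewrite notin_setE/= in_itv/= xt andbT => /negP; rewrite -ltNge => xa.
by congr EFin; apply/eqP; rewrite eq_le rcdf_ge0 andbT -Fa rcdf_le// ltW.
Qed.

End random_variable_cdf.

(** * Power laws and proportionality of extropy to inactivity time *)

Theorem theorem3p9 (n : nat) (n_ge1 : (1 <= n)%N)
    (R : realType) (d : measure_display) (T : measurableType d)
    (P : probability T R) (X : {RV P >-> R}) (b : R) (b_gt0 : 0 < b)
    (X_ac : absolutely_continuous_law X)
    (X_supp : support_endpoints X 0 b) :
  power_distribution X b <->
  exists k : R, forall t : R, 0 < t -> t < b ->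
    dcp_extropy_max X n t = k * inactivity_time X t.
Proof.
case: X_supp => supp0 _ supp.
have cF := rcdf_continuous _ _ X_ac.
have F0 := rcdf_support_left _ _ _ _ X_ac supp.
have Fb := rcdf_support_right _ _ _ _ X_ac supp.
have Fgt0 (t : R) : 0 < t -> 0 < rcdf X t by exact: rcdf_gt0.
have mE t : inactivity_time X t =
    (\int[@lebesgue_measure R]_(x in `[0, t]) rcdf X x) / rcdf X t.
  by rewrite /inactivity_time (Rintegral_inactivity _ _ _ _ F0).
(* Since [n >= 1], the exponent [2 * n] is at least 2, so [2 * n - 1] becomes the successor
   [m.+1]. *)
have [m mn] : exists m, (2 * n = m.+2)%N.
  by case: n n_ge1 => // k _; exists (k.*2); rewrite mul2n.
split=> [[c c0 Fc]|[k Hk]].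
- have FE (t x : R) : 0 < t -> t < b -> x \in `[0, t]%classic ->
      rcdf X x = x `^ c / b `^ c.
    move=> t0 tb; rewrite inE/= in_itv/= => /andP[+ xt].
    rewrite le_eqVlt => /predU1P[<-|x0]; first by rewrite F0 powR0 ?gt_eqF// mul0r.
    rewrite Fc ?(le_lt_trans xt)// powRM ?ltW ?invr_gt0//.
    by rewrite -powR_inv1 ?ltW// -!powRrM mulN1r powRN.
  have bc0 : 0 < b `^ c by rewrite powR_gt0.
  have mp0 : 0 < c * m.+2%:R by rewrite mulr_gt0.
  (* For the power law the inactivity time is [t / (c + 1)] and the integral in the extropy is
     [t / (c * m.+2%:R + 1)]; this is their ratio times [- (1 / 2)]. *)
  exists (- (1 / 2) * ((c + 1) / (c * m.+2%:R + 1))) => t t0 tb.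
  have tc0 : 0 < t `^ c by rewrite powR_gt0.
  have powS a : t `^ (a + 1) = t `^ a * t.
    by rewrite powRD ?(gt_eqF t0) ?implybT// powRr1 ?ltW.
  have FtE : rcdf X t = t `^ c / b `^ c.
    by apply: (FE t) => //; rewrite inE/= in_itv/= lexx ltW.
  rewrite /dcp_extropy_max mE mn -mulrA; congr (_ * _).
  (* The scale [b] cancels in the quotient of cdf values. *)
  have -> : \int[@lebesgue_measure R]_(x in `[0, t]) (rcdf X x / rcdf X t) ^+ m.+2 =
      (\int[@lebesgue_measure R]_(x in `[0, t]) (x `^ (c * m.+2%:R))) /
      t `^ (c * m.+2%:R).
    rewrite -RintegralZr//; last exact: integrable_powR.
    apply: eq_Rintegral => x xt; rewrite (FE t)// FtE !powRrM !powR_mulrn ?powR_ge0//.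
    by rewrite -exprVn -exprMn; congr (_ ^+ _); field; rewrite !gt_eqF.
  have -> : \int[@lebesgue_measure R]_(x in `[0, t]) rcdf X x =
      (\int[@lebesgue_measure R]_(x in `[0, t]) (x `^ c)) / b `^ c.
    rewrite -RintegralZr//; last exact: integrable_powR.
    by apply: eq_Rintegral => x xt; rewrite (FE t).
  rewrite !Rintegral_powR// FtE !powS.
  have tm0 : 0 < t `^ (c * m.+2%:R) by rewrite powR_gt0.
  field; rewrite !gt_eqF//; lra.
- apply: (power_of_proportional_primitives _ _ m (-2 * k) b_gt0 cF _ F0 Fgt0 Fb).
  + exact: rcdf_le.
  + move=> t t0 tb; have := Hk _ t0 tb; rewrite /dcp_extropy_max mE mn.
    have cFm : continuous (fun x => rcdf X x ^+ m.+2).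
      move=> x; exact: (continuous_comp (cF x) (@exprn_continuous R m.+2 (rcdf X x))).
    have -> : \int[@lebesgue_measure R]_(x in `[0, t]) (rcdf X x / rcdf X t) ^+ m.+2 =
        (\int[@lebesgue_measure R]_(x in `[0, t]) (rcdf X x ^+ m.+2)) / rcdf X t ^+ m.+2.
      rewrite -RintegralZr//; last exact: continuous_itvcc_integrable.
      by apply: eq_Rintegral => x _; rewrite expr_div_n.
    move=> E; have Ft := Fgt0 _ t0.
    set H := (X in X = _); set G := (X in _ = _ * (_ * X)); move: E; rewrite -/H -/G => E.
    (* [H] is rewritten so that the extropy appears as a factor and [E] applies. *)
    have -> : H = -2 * rcdf X t ^+ m.+2 * (- (1 / 2) * (H / rcdf X t ^+ m.+2)).
      by field; rewrite gt_eqF// exprn_gt0.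
    rewrite E exprS; field; by rewrite gt_eqF.
Qed.
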